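(* Let $A\in\mathbb{R}^{n\times n}$, $B_1\in\mathbb{R}^{n\times d}$, $B_2\in\mathbb{R}^{n\times e}$, $B_3\in\mathbb{R}^{n\times m}$, $C_1\in\mathbb{R}^{q\times n}$, $F_1\in\mathbb{R}^{q\times e}$, $D_1\in\mathbb{R}^{q\times m}$, $C_2\in\mathbb{R}^{p\times n}$, $F_2\in\mathbb{R}^{p\times e}$, $D_2\in\mathbb{R}^{p\times m}$, let $f(t,\cdot):\mathbb{R}^q\to\mathbb{R}^d$ for $t\in\mathbb{N}$, and consider the controlled discrete-time Lur'e system $$x_{t+1}=Ax_t+B_1z_t+B_2w_t+B_3u_t,\qquad z_t=f(t,\,C_1x_t+F_1w_t+D_1u_t),\qquad y_t=C_2x_t+F_2w_t+D_2u_t,\qquad t\in\mathbb{N},$$ with state $x_t\in\mathbb{R}^n$, external input $w_t\in\mathbb{R}^e$, controlled input $u_t\in\mathbb{R}^m$ and output $y_t\in\mathbb{R}^p$. Let an affine offset $g\in\mathbb{R}^m$ be given. Assume: (A1) $\Delta\in\mathbb{R}^{d\times q}_{\ge 0}$ is a matrix such that for all $\zeta_1,\zeta_2\in\mathbb{R}^q$, $\sup_{t\in\mathbb{N}}|f(t,\zeta_1)-f(t,\zeta_2)|\le \Delta|\zeta_1-\zeta_2|$ (elementwise); (A2) the matrices $B_1,B_2,F_1,F_2$ are elementwise nonnegative; (A3) the matrices $A,C_1,C_2$ are elementwise nonnegative. Put $A_\Delta:=A+B_1\Delta C_1$ and $B_\Delta:=B_2+B_1\Delta F_1$, and let $\eta\in\mathbb{R}$.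 Suppose there exist $v\in\mathbb{R}^n_{>0}$, $X=\mathrm{diag}(v)$ and $Y\in\mathbb{R}^{m\times n}$ such that $$v-\bigl(A_\Delta X+(B_3+B_1\Delta D_1)Y\bigr)\mathbf{1}_n-B_\Delta\mathbf{1}_e\in\mathbb{R}^n_{>0},$$ $$\eta\mathbf{1}_p-F_2\mathbf{1}_e-C_2v-D_2Y\mathbf{1}_n\in\mathbb{R}^p_{>0},$$ $$AX+B_3Y\in\mathbb{R}^{n\times n}_{\ge0},\qquad C_1X+D_1Y\in\mathbb{R}^{q\times n}_{\ge0},\qquad C_2X+D_2Y\in\mathbb{R}^{p\times n}_{\ge0}.$$ Then there exists a matrix $K\in\mathbb{R}^{m\times n}$ such that the system in closed loop with the law $u_t=Kx_t+g$ has incremental $\ell_\infty$ gain $w\to y$ at most $\eta$; moreover, such a controller matrix is given by $K=YX^{-1}$.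
   Context: $\mathbb{N}$ includes $0$. $\mathbb{R}^n_{>0}$ (resp. $\mathbb{R}^n_{\ge0}$) is the set of vectors with all entries positive (resp. nonnegative), and similarly for matrices. $\mathbf{1}_n$ is the all-ones vector in $\mathbb{R}^n$; $\mathrm{diag}(v)$ is the diagonal matrix with diagonal $v$. $|x|$ is the elementwise absolute value of a vector or matrix, and inequalities between vectors are elementwise (the supremum over $t$ in (A1) is also elementwise). For a sequence $y=\{y_t\}_{t\in\mathbb{N}}$ of vectors, $\|y\|_\infty=\sup_{t\in\mathbb{N}}\|y_t\|_\infty$, where $\|y_t\|_\infty$ is the maximum absolute entry of $y_t$. The incremental $\ell_\infty$ gain $w\to y$ of a (closed-loop) system is $$\sup_{w^1,w^2}\frac{\|y^1-y^2\|_\infty}{\|w^1-w^2\|_\infty},$$ where the supremum is over all input-output pairs $(w^1,y^1),(w^2,y^2)$ of the system generated from the same initial condition $x_0$ (for any such $x_0$), with $0<\|w^1-w^2\|_\infty<\infty$ so that the ratio is meaningful. *)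

(* Defs.v *)
From HB Require Import structures.
From mathcomp Require Import all_boot all_order all_algebra.
From mathcomp Require Import boolp classical_sets reals ereal normedtype.

Set Implicit Arguments.
Unset Strict Implicit.
Unset Printing Implicit Defensive.

Import Order.TTheory GRing.Theory Num.Theory.
Import numFieldNormedType.Exports.
Local Open Scope classical_set_scope.
Local Open Scope ring_scope.

Definition abs_mx (R : realType) (k l : nat) (M : 'M[R]_(k, l)) : 'M[R]_(k, l) :=
  map_mx (fun a : R => `|a|) M.

Definition ones (R : realType) (k : nat) : 'cV[R]_k := const_mx 1.

(* On matrices, `| _ | is the library norm mx_norm: the maximum absolute entry. *)
Definition linfty_norm (R : realType) (k : nat) (y : nat -> 'cV[R]_k) : \bar R :=
  ereal_sup (range (fun t => `|y t|%:E)).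

(* A system is given by its input-output behaviour: [sys x0 w y] means that
   (w, y) is an input-output pair generated from the initial condition x0.
   Without any admissible pair (no inputs at all), the supremum is -oo. *)
Definition incremental_linfty_gain (R : realType) (n e p : nat)
    (sys : 'cV[R]_n -> (nat -> 'cV[R]_e) -> (nat -> 'cV[R]_p) -> Prop) : \bar R :=
  ereal_sup [set r : \bar R | exists (x0 : 'cV[R]_n)
      (w1 w2 : nat -> 'cV[R]_e) (y1 y2 : nat -> 'cV[R]_p),
    let dw t : 'cV[R]_e := w1 t - w2 t in
    let dy t : 'cV[R]_p := y1 t - y2 t in
    [/\ sys x0 w1 y1, sys x0 w2 y2, (0 < linfty_norm dw < +oo)%E
      & r = (linfty_norm dy / linfty_norm dw)%E]].

Record lure_system (R : realType) (n d e m q p : nat) := LureSystem {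
  lureA : 'M[R]_n;
  lureB1 : 'M[R]_(n, d);
  lureB2 : 'M[R]_(n, e);
  lureB3 : 'M[R]_(n, m);
  lureC1 : 'M[R]_(q, n);
  lureF1 : 'M[R]_(q, e);
  lureD1 : 'M[R]_(q, m);
  lureC2 : 'M[R]_(p, n);
  lureF2 : 'M[R]_(p, e);
  lureD2 : 'M[R]_(p, m);
  luref : nat -> 'cV[R]_q -> 'cV[R]_d }.

Definition lure_trajectory (R : realType) (n d e m q p : nat)
    (S : lure_system R n d e m q p) (x : nat -> 'cV[R]_n) (z : nat -> 'cV[R]_d)
    (w : nat -> 'cV[R]_e) (u : nat -> 'cV[R]_m) (y : nat -> 'cV[R]_p) : Prop :=
  forall t : nat,
    [/\ x t.+1 = lureA S *m x t + lureB1 S *m z t + lureB2 S *m w t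
                 + lureB3 S *m u t,
        z t = luref S t (lureC1 S *m x t + lureF1 S *m w t + lureD1 S *m u t)
      & y t = lureC2 S *m x t + lureF2 S *m w t + lureD2 S *m u t].

Definition closed_loop (R : realType) (n d e m q p : nat)
    (S : lure_system R n d e m q p) (K : 'M[R]_(m, n)) (g : 'cV[R]_m)
    (x0 : 'cV[R]_n) (w : nat -> 'cV[R]_e) (y : nat -> 'cV[R]_p) : Prop :=
  exists (x : nat -> 'cV[R]_n) (z : nat -> 'cV[R]_d) (u : nat -> 'cV[R]_m),
    [/\ x 0%N = x0, forall t : nat, u t = K *m x t + g
      & lure_trajectory S x z w u y].

(* Main.v *)
Require Import Defs.
From mathcomp Require Import all_boot all_order all_algebra.
From mathcomp Require Import boolp classical_sets reals ereal normedtype.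
From mathcomp Require Import ring.

Set Implicit Arguments.
Unset Strict Implicit.
Unset Printing Implicit Defensive.

Import Order.TTheory GRing.Theory Num.Theory.
Import numFieldNormedType.Exports.
Local Open Scope classical_set_scope.
Local Open Scope ring_scope.

(** The closed loop under [u = K x + g] is again a Lur'e system, with [A], [C1],
    [C2] replaced by [A + B3 K], [C1 + D1 K], [C2 + D2 K]; the offset [g] cancels
    in the difference of two trajectories.  For [K = Y X^-1] these three matrices
    are the products of [A X + B3 Y], [C1 X + D1 Y], [C2 X + D2 Y] with the
    nonnegative diagonal matrix [X^-1], so they are nonnegative, and absolute
    values pass through all coefficient matrices of the closed loop.  Hence the absolute
    difference of two trajectories is dominated by the positive linear comparison
    system
    [[
      xi+ = (A + B3 K) xi + B1 Delta ((C1 + D1 K) xi + F1 omega) + B2 omega,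
      upsilon = (C2 + D2 K) xi + F2 omega.
    ]]
    If all entries of [|w1 - w2|] are at most [c], the first linear inequality of
    the theorem, read through [K v = Y 1], says that the box [xi <= c v] is
    invariant under the comparison system.  It contains the initial difference
    [0], so [|x1 - x2| <= c v] at all times ([lure_incremental_bound]), and the
    second inequality turns this into [|y1 - y2| <= c eta].  Taking for [c] the
    norm of [w1 - w2] bounds every ratio in the definition of the gain
    ([incremental_gain_le]). *)

(** * Entrywise order on matrices *)

Definition lemx (R : realType) (k l : nat) (M N : 'M[R]_(k, l)) : Prop :=
  forall i j, M i j <= N i j.

Local Notation "M <=m N" := (lemx M N) (at level 70, no associativity).

Section EntrywiseOrder.
Variable R : realType.

Lemma lemx_trans k l (N M P : 'M[R]_(k, l)) : M <=m N -> N <=m P -> M <=m P.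
Proof. by move=> MN NP i j; exact: le_trans (MN i j) (NP i j). Qed.

Lemma lemxD k l (M M' N N' : 'M[R]_(k, l)) :
  M <=m N -> M' <=m N' -> M + M' <=m N + N'.
Proof. by move=> MN MN' i j; rewrite !mxE lerD. Qed.

Lemma lemxZ k l (c : R) (M N : 'M[R]_(k, l)) :
  0 <= c -> M <=m N -> c *: M <=m c *: N.
Proof. by move=> c0 MN i j; rewrite !mxE ler_wpM2l. Qed.

Lemma lemx_mull k l r (P : 'M[R]_(k, l)) (M N : 'M[R]_(l, r)) :
  P \is a mxOver Num.nneg -> M <=m N -> P *m M <=m P *m N.
Proof.
move=> /mxOverP P0 MN i j; rewrite !mxE; apply: ler_sum => s _.
by apply: ler_wpM2l (MN _ _); have := P0 i s; rewrite nnegrE.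
Qed.

Lemma subr_pos_lemx k l (M N : 'M[R]_(k, l)) :
  N - M \is a mxOver Num.pos -> M <=m N.
Proof.
by move=> /mxOverP NM i j; have := NM i j; rewrite posrE !mxE subr_gt0 => /ltW.
Qed.

Lemma abs_mxD k l (M N : 'M[R]_(k, l)) : abs_mx (M + N) <=m abs_mx M + abs_mx N.
Proof. by move=> i j; rewrite !mxE ler_normD. Qed.

Lemma abs_mulmx_le k l r (P : 'M[R]_(k, l)) (M : 'M[R]_(l, r)) :
  P \is a mxOver Num.nneg -> abs_mx (P *m M) <=m P *m abs_mx M.
Proof.
move=> /mxOverP P0 i j; rewrite !mxE (le_trans (ler_norm_sum _ _ _)) //.
apply: ler_sum => s _; rewrite !mxE normrM ger0_norm //.
by have := P0 i s; rewrite nnegrE.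
Qed.

(** The one-step estimate behind every bound below: a nonnegative coefficient
    matrix transports a bound on an absolute value. *)
Lemma abs_mulmx_bound k l r (P : 'M[R]_(k, l)) (M N : 'M[R]_(l, r)) :
  P \is a mxOver Num.nneg -> abs_mx M <=m N -> abs_mx (P *m M) <=m P *m N.
Proof.
by move=> P0 MN; apply: lemx_trans (abs_mulmx_le _ P0) (lemx_mull P0 MN).
Qed.

Lemma abs_mxD_bound k l (M M' N N' : 'M[R]_(k, l)) :
  abs_mx M <=m N -> abs_mx M' <=m N' -> abs_mx (M + M') <=m N + N'.
Proof. by move=> MN MN'; apply: lemx_trans (abs_mxD _ _) (lemxD MN MN'). Qed.

End EntrywiseOrder.

(** * Sup norms and the incremental gain *)

Section SupNorm.
Variable R : realType.

Lemma abs_mx_le_norm k (x : 'cV[R]_k) (c : R) :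
  `|x| <= c -> abs_mx x <=m c *: ones R k.
Proof.
move=> xc i j; rewrite !mxE mulr1; apply: le_trans xc.
rewrite /Num.norm/= mx_normrE.
exact: (le_bigmax _ (fun ij : 'I_k * 'I_1 => `|x ij.1 ij.2|) (i, j)).
Qed.

(** A dimension [0 < k] is required because the norm of the empty vector is [0],
    while the entrywise bound would put no constraint on [c]. *)
Lemma norm_le_abs_mx k (x : 'cV[R]_k) (c : R) : (0 < k)%N ->
  abs_mx x <=m c *: ones R k -> `|x| <= c.
Proof.
move=> k0 xc; have {}xc i j : `|x i j| <= c.
  by have := xc i j; rewrite !mxE mulr1.
rewrite /Num.norm/= mx_normrE; apply: bigmax_le => [|ij _]; last exact: xc.
exact: le_trans (xc (Ordinal k0) ord0).
Qed.

Lemma linfty_norm_ge k (y : nat -> 'cV[R]_k) t : (`|y t|%:E <= linfty_norm y)%E.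
Proof. by apply: ereal_sup_ubound; exists t. Qed.

(** The admissible input differences have a finite positive norm [c], so that the
    gain is controlled by a homogeneous implication between entrywise bounds. *)
Lemma incremental_gain_le n e p
    (sys : 'cV[R]_n -> (nat -> 'cV[R]_e) -> (nat -> 'cV[R]_p) -> Prop) (eta : R) :
  (0 < p)%N ->
  (forall x0 w1 w2 y1 y2 (c : R), sys x0 w1 y1 -> sys x0 w2 y2 -> 0 < c ->
     (forall t, abs_mx (w1 t - w2 t) <=m c *: ones R e) ->
     forall t, abs_mx (y1 t - y2 t) <=m (eta * c) *: ones R p) ->
  (incremental_linfty_gain sys <= eta%:E)%E.
Proof.
move=> p0 H; apply: ge_ereal_sup => r [x0 [w1 [w2 [y1 [y2 /= [s1 s2]]]]]].
have := linfty_norm_ge (fun t => w1 t - w2 t).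
case: (linfty_norm _) => [c| |] //=; rewrite ?ltxx ?andbF //.
move=> wc /andP[c0 _] ->; rewrite lte_fin in c0.
rewrite inver gt_eqF // lee_pdivrMr // -EFinM.
apply: ge_ereal_sup => _ [t _ <-]; rewrite lee_fin.
apply: norm_le_abs_mx => //; apply: H s1 s2 c0 _ t => t.
by apply: abs_mx_le_norm; have := wc t; rewrite lee_fin.
Qed.

End SupNorm.

(** * Comparison with a positive linear system *)

Section Comparison.
Variables (R : realType) (n d e m q p : nat) (S : lure_system R n d e m q p).
Variables (K : 'M[R]_(m, n)) (g : 'cV[R]_m) (Delta : 'M[R]_(d, q)).
Variables (v : 'cV[R]_n) (eta : R).

Let M := lureA S + lureB3 S *m K.
Let N := lureC1 S + lureD1 S *m K.
Let P := lureC2 S + lureD2 S *m K.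

Hypothesis f_lip : forall t zeta1 zeta2,
  abs_mx (luref S t zeta1 - luref S t zeta2) <=m Delta *m abs_mx (zeta1 - zeta2).
Hypotheses (Delta_ge0 : Delta \is a mxOver Num.nneg)
  (B1_ge0 : lureB1 S \is a mxOver Num.nneg)
  (B2_ge0 : lureB2 S \is a mxOver Num.nneg)
  (F1_ge0 : lureF1 S \is a mxOver Num.nneg)
  (F2_ge0 : lureF2 S \is a mxOver Num.nneg)
  (M_ge0 : M \is a mxOver Num.nneg) (N_ge0 : N \is a mxOver Num.nneg)
  (P_ge0 : P \is a mxOver Num.nneg) (v_ge0 : v \is a mxOver Num.nneg).
Hypothesis state_le :
  M *m v + lureB1 S *m (Delta *m (N *m v + lureF1 S *m ones R e))
    + lureB2 S *m ones R e <=m v.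
Hypothesis output_le : P *m v + lureF2 S *m ones R e <=m eta *: ones R p.

Lemma feedback_sub k (E : 'M[R]_(k, n)) (F : 'M[R]_(k, e)) (G : 'M[R]_(k, m))
    (x1 x2 : 'cV[R]_n) (w1 w2 : 'cV[R]_e) :
  (E *m x1 + F *m w1 + G *m (K *m x1 + g))
    - (E *m x2 + F *m w2 + G *m (K *m x2 + g))
  = (E + G *m K) *m (x1 - x2) + F *m (w1 - w2).
Proof.
rewrite !mulmxDl !mulmxBr !mulmxDr !mulmxA.
by apply/matrixP => i j; rewrite !mxE; ring.
Qed.

(** Induction on time: the box [|x1 - x2| <= c v] contains the initial
    difference, and [state_le] makes it invariant. *)
Lemma lure_incremental_bound x0 w1 w2 y1 y2 (c : R) :
  closed_loop S K g x0 w1 y1 -> closed_loop S K g x0 w2 y2 -> 0 <= c ->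
  (forall t, abs_mx (w1 t - w2 t) <=m c *: ones R e) ->
  forall t, abs_mx (y1 t - y2 t) <=m (eta * c) *: ones R p.
Proof.
move=> [x1 [z1 [u1 [x10 u1E tr1]]]] [x2 [z2 [u2 [x20 u2E tr2]]]] c0 wc.
have affine_bound k (E : 'M[R]_(k, n)) (F : 'M[R]_(k, e)) (G : 'M[R]_(k, m)) t :
    E + G *m K \is a mxOver Num.nneg -> F \is a mxOver Num.nneg ->
    abs_mx (x1 t - x2 t) <=m c *: v ->
    abs_mx ((E *m x1 t + F *m w1 t + G *m u1 t)
            - (E *m x2 t + F *m w2 t + G *m u2 t))
      <=m c *: ((E + G *m K) *m v + F *m ones R e).
  move=> EGK0 F0 xt; rewrite u1E u2E feedback_sub scalerDr !scalemxAr.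
  by apply: abs_mxD_bound; exact: abs_mulmx_bound.
have xb t : abs_mx (x1 t - x2 t) <=m c *: v.
  elim: t => [|t IH].
    move=> i j; rewrite x10 x20 subrr !mxE normr0 mulr_ge0 //.
    by move/mxOverP: v_ge0 => /(_ i j); rewrite nnegrE.
  have zb : abs_mx (z1 t - z2 t)
      <=m c *: (Delta *m (N *m v + lureF1 S *m ones R e)).
    have [_ -> _] := tr1 t; have [_ -> _] := tr2 t.
    apply: lemx_trans (f_lip _ _ _) _; rewrite scalemxAr.
    exact: lemx_mull Delta_ge0 (affine_bound _ _ _ (lureD1 S) _ N_ge0 F1_ge0 IH).
  have [-> _ _] := tr1 t; have [-> _ _] := tr2 t.
  (* The z part is bounded through f_lip and not by linearity, so it is set apart. *)
  have -> : forall a b w u a' b' w' u' : 'cV[R]_n,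
      a + b + w + u - (a' + b' + w' + u') = (a + w + u - (a' + w' + u')) + (b - b').
    by move=> *; apply/matrixP => i j; rewrite !mxE; ring.
  apply: (lemx_trans _ (lemxZ c0 state_le)).
  rewrite [X in _ <=m _ *: X]addrAC scalerDr -mulmxBr (scalemxAr _ (lureB1 S)).
  apply: abs_mxD_bound; first exact: (affine_bound _ _ _ (lureB3 S) _ M_ge0 B2_ge0 IH).
  exact: abs_mulmx_bound B1_ge0 zb.
move=> t; have [_ _ ->] := tr1 t; have [_ _ ->] := tr2 t.
rewrite mulrC -scalerA.
apply: (lemx_trans _ (lemxZ c0 output_le)).
exact: (affine_bound _ _ _ (lureD2 S) _ P_ge0 F2_ge0 (xb t)).
Qed.

End Comparison.

(** * Change of variables [Y = K X] *)

Section Scaling.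
Variables (R : realType) (n : nat) (v : 'cV[R]_n).
Hypothesis v_gt0 : v \is a mxOver Num.pos.

Let X := diag_mx v^T.

Lemma pos_entry_gt0 i : 0 < v i ord0.
Proof. by move/mxOverP: v_gt0 => /(_ i ord0); rewrite posrE. Qed.

Lemma diag_pos_unit : X \in unitmx.
Proof.
rewrite unitmxE det_diag unitfE; apply/prodf_neq0 => i _.
by rewrite mxE gt_eqF // pos_entry_gt0.
Qed.

Lemma diag_mul_ones : X *m ones R n = v.
Proof.
apply/matrixP => i j; rewrite mul_diag_mx !mxE mulr1.
by rewrite ord1.
Qed.

(** [X] scales columns by positive factors, so signs can be read off after
    multiplication by [X]; this avoids a formula for the entries of [X^-1]. *)
Lemma mul_diag_pos_nneg k (M : 'M[R]_(k, n)) :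
  M *m X \is a mxOver Num.nneg -> M \is a mxOver Num.nneg.
Proof.
move=> /mxOverP MX; apply/mxOverP => i j; have := MX i j.
by rewrite mul_mx_diag !nnegrE !mxE pmulr_lge0 // pos_entry_gt0.
Qed.

Lemma feedback_diag k m (E : 'M[R]_(k, n)) (G : 'M[R]_(k, m)) (Y : 'M[R]_(m, n)) :
  (E + G *m (Y *m invmx X)) *m X = E *m X + G *m Y.
Proof. by rewrite mulmxDl !mulmxA mulmxKV // diag_pos_unit. Qed.

End Scaling.

Theorem theorem3 (R : realType) (n d e m q p : nat) (hp : (0 < p)%N)
    (A : 'M[R]_n) (B1 : 'M[R]_(n, d)) (B2 : 'M[R]_(n, e)) (B3 : 'M[R]_(n, m))
    (C1 : 'M[R]_(q, n)) (F1 : 'M[R]_(q, e)) (D1 : 'M[R]_(q, m))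
    (C2 : 'M[R]_(p, n)) (F2 : 'M[R]_(p, e)) (D2 : 'M[R]_(p, m))
    (f : nat -> 'cV[R]_q -> 'cV[R]_d) (g : 'cV[R]_m)
    (Delta : 'M[R]_(d, q)) (eta : R)
    (hDelta : Delta \is a mxOver Num.nneg)
    (hf : forall (zeta1 zeta2 : 'cV[R]_q) (i : 'I_d),
      (ereal_sup (range (fun t : nat =>
         (abs_mx (f t zeta1 - f t zeta2) i ord0)%:E))
       <= ((Delta *m abs_mx (zeta1 - zeta2)) i ord0)%:E)%E)
    (hB1 : B1 \is a mxOver Num.nneg) (hB2 : B2 \is a mxOver Num.nneg)
    (hF1 : F1 \is a mxOver Num.nneg) (hF2 : F2 \is a mxOver Num.nneg)
    (hA : A \is a mxOver Num.nneg) (hC1 : C1 \is a mxOver Num.nneg)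
    (hC2 : C2 \is a mxOver Num.nneg)
    (v : 'cV[R]_n) (Y : 'M[R]_(m, n)) :
  let A_Delta := A + B1 *m Delta *m C1 in
  let B_Delta := B2 + B1 *m Delta *m F1 in
  let X := diag_mx v^T in
  v \is a mxOver Num.pos ->
  v - (A_Delta *m X + (B3 + B1 *m Delta *m D1) *m Y) *m ones R n
    - B_Delta *m ones R e \is a mxOver Num.pos ->
  eta *: ones R p - F2 *m ones R e - C2 *m v - D2 *m Y *m ones R n
    \is a mxOver Num.pos ->
  A *m X + B3 *m Y \is a mxOver Num.nneg ->
  C1 *m X + D1 *m Y \is a mxOver Num.nneg ->
  C2 *m X + D2 *m Y \is a mxOver Num.nneg ->
  let S := LureSystem A B1 B2 B3 C1 F1 D1 C2 F2 D2 f in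
  (exists K : 'M[R]_(m, n),
     (incremental_linfty_gain (closed_loop S K g) <= eta%:E)%E)
  /\ (incremental_linfty_gain (closed_loop S (Y *m invmx X) g) <= eta%:E)%E.
Proof.
move=> A_Delta B_Delta X v_gt0 state_gt0 output_gt0 AX C1X C2X S.
suff gainK : (incremental_linfty_gain (closed_loop S (Y *m invmx X) g) <= eta%:E)%E.
  by split=> //; exists (Y *m invmx X).
set K := Y *m invmx X.
have f_lip t zeta1 zeta2 :
    lemx (abs_mx (f t zeta1 - f t zeta2)) (Delta *m abs_mx (zeta1 - zeta2)).
  move=> i j; rewrite ord1 -lee_fin; apply: le_trans (hf zeta1 zeta2 i).
  by apply: ereal_sup_ubound; exists t.
have fbX k (E : 'M_(k, n)) (G : 'M_(k, m)) : (E + G *m K) *m X = E *m X + G *m Y.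
  exact: feedback_diag.
have fbv k (E : 'M_(k, n)) (G : 'M_(k, m)) :
    (E + G *m K) *m v = E *m v + G *m (Y *m ones R n).
  by rewrite -(diag_mul_ones v) mulmxA fbX mulmxDl !mulmxA.
have nneg k (E : 'M_(k, n)) (G : 'M_(k, m)) :
    E *m X + G *m Y \is a mxOver Num.nneg -> E + G *m K \is a mxOver Num.nneg.
  by rewrite -fbX; exact: mul_diag_pos_nneg.
apply: incremental_gain_le => // x0 w1 w2 y1 y2 c s1 s2 /ltW c_ge0.
apply: (lure_incremental_bound (S := S) (v := v) f_lip) s1 s2 c_ge0 => //=.
- exact: nneg.
- exact: nneg.
- exact: nneg.
- by apply: mxOverS v_gt0 => a; rewrite posrE nnegrE => /ltW.
- apply: subr_pos_lemx; move: state_gt0.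
  rewrite -addrA -opprD !fbv; congr (_ - _ \is a _).
  rewrite /A_Delta /B_Delta !mulmxDl -!mulmxA -/X diag_mul_ones !mulmxDr.
  by apply/matrixP => i j; rewrite !mxE; ring.
- apply: subr_pos_lemx; move: output_gt0.
  rewrite -!addrA -!opprD fbv -!mulmxA; congr (_ - _ \is a _).
  by apply/matrixP => i j; rewrite !mxE; ring.
Qed.
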